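(* For any $x\in\mathbb{Z}_+^{\mathcal{R}}$, the following inequalities hold: $$\delta_K^*(x)\le\phi(x)\le\delta_K^*(x)+r(x),$$ where $$r(x):=\sum_{s\in\mathcal{R}:\,x_s>0}\ \sum_{m=1}^{x_s}\frac1m.$$
   Context: $\mathcal{R}$ is a finite set (of user types); $e_s$ is the $s$-th unit vector of $\mathbb{R}^{\mathcal{R}}$. The capacity set $\mathcal{C}\subset\mathbb{R}_+^{\mathcal{R}}$ is convex and nonincreasing (if $\lambda,\lambda'\in\mathbb{R}_+^{\mathcal{R}}$, $\lambda_s\le\lambda'_s$ for all $s\in\mathcal{R}$ and $\lambda'\in\mathcal{C}$, then $\lambda\in\mathcal{C}$). The set $K\subset\mathbb{R}^{\mathcal{R}}$ is defined by $\gamma\in K\Leftrightarrow(e^{\gamma_s})_{s\in\mathcal{R}}\in\mathcal{C}$; $\delta_K$ equals $0$ on $K$ and $+\infty$ outside $K$; $\delta_K^*(x)=\sup_{\gamma\in\mathbb{R}^{\mathcal{R}}}(\langle\gamma,x\rangle-\delta_K(\gamma))$ is its Fenchel–Legendre conjugate. The balance function $\psi$ (of the balanced fairness allocation) is defined by induction on $\mathbb{Z}_+^{\mathcal{R}}$, starting from $\psi(0)=1$, $\psi(x)=0$ for any $x$ not in $\mathbb{R}_+^{\mathcal{R}}$, and $\psi(x)=\inf\{a>0:(a^{-1}\psi(x-e_s))_{s\in\mathcal{R}}\in\mathcal{C}\}$; $\phi(x)=-\log\psi(x)$.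
   Formalization: K is additionally assumed nonempty (the capacity set contains a point with all coordinates positive); otherwise δ_K^* is identically −∞ while φ(0)=0, so the upper bound fails at x=0. *)

(* Defs.v *)
From mathcomp Require Import all_boot all_order all_algebra.
From mathcomp Require Import all_classical all_reals all_analysis.

Set Implicit Arguments.
Unset Strict Implicit.
Unset Printing Implicit Defensive.

Import Order.TTheory GRing.Theory Num.Theory.

Local Open Scope classical_set_scope.
Local Open Scope ring_scope.

Section BalancedFairness.
Variables (T : finType) (R : realType).

Definition orthant : set (T -> R^o) := [set l | forall s, 0 <= l s].

(* Monotonicity is only required among vectors of the orthant. *)
Definition nonincreasing_set (C : set (T -> R^o)) :=
  forall l l' : T -> R^o, orthant l -> orthant l' ->
    (forall s, l s <= l' s) -> C l' -> C l.

Definition dotp (g y : T -> R^o) : R := \sum_s g s * y s.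

Definition indicator_fun (K : set (T -> R^o)) (g : T -> R^o) : \bar R :=
  if pselect (K g) then 0%E else +oo%E.

Definition fenchel (f : (T -> R^o) -> \bar R) (y : T -> R^o) : \bar R :=
  ereal_sup (range (fun g : T -> R^o => ((dotp g y)%:E - f g)%E)).

(* Nonempty exactly when C has a point with all coordinates positive; otherwise
   the conjugate of its indicator is identically -oo. *)
Definition log_set (C : set (T -> R^o)) : set (T -> R^o) :=
  [set g | C (fun s => expR (g s))].

Definition unitv (s : T) : {ffun T -> int} := [ffun t => (t == s)%:R].

(* inf {a > 0 : (a^-1 v_s)_s \in C}, taken in the extended reals (inf of the
   empty set is +oo).  A family v with an infinite entry is never of the form
   a *: l with l \in C. *)
Definition minkowski_gauge (C : set (T -> R^o)) (v : T -> \bar R) : \bar R :=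
  ereal_inf [set a%:E | a in
    [set a : R | 0 < a /\
       exists2 l : T -> R^o, C l & forall s, (l s)%:E = (a^-1%:E * v s)%E]].

(* The recursion lowers \sum_s x s by one at each step, so n is instantiated
   with that sum; see psi0, psi_out and psiE for the defining
   equations. *)
Fixpoint psi_rec (C : set (T -> R^o)) (n : nat) (x : {ffun T -> int})
    : \bar R :=
  if [forall s, 0 <= x s] then
    if n is m.+1 then minkowski_gauge C (fun s => psi_rec C m (x - unitv s))
    else 1%E
  else 0%E.

Definition psi (C : set (T -> R^o)) (x : {ffun T -> int}) : \bar R :=
  psi_rec C (absz (\sum_s x s)) x.

(* lne 0 = -oo, so phi is +oo where psi vanishes (C may be unbounded). *)
Definition phi (C : set (T -> R^o)) (x : {ffun T -> int}) : \bar R :=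
  (- lne (psi C x))%E.

Definition vec_of_int (x : {ffun T -> int}) : T -> R^o := fun s => (x s)%:~R.

Definition harmonic_gap (x : {ffun T -> int}) : R :=
  \sum_(s | 0 < x s) \sum_(1 <= m < (absz (x s)).+1) m%:R^-1.

Lemma psi0 C : psi C 0 = 1%E.
Proof.
rewrite /psi big1 => [|s _]; last by rewrite ffunE.
rewrite /=; case: ifPn => // /negP[]; apply/forallP => s.
by rewrite ffunE.
Qed.

Lemma psi_out C (x : {ffun T -> int}) : ~ (forall s, 0 <= x s) -> psi C x = 0%E.
Proof.
move=> xN; rewrite /psi; case: (absz _) => [|n] /=; case: ifPn => // /forallP //.
Qed.

Lemma psiE C (x : {ffun T -> int}) : (forall s, 0 <= x s) -> x != 0 ->
  psi C x = minkowski_gauge C (fun s => psi C (x - unitv s)).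
Proof.
move=> x0 xn0.
have [t xt] : exists t, 0 < x t.
  apply/existsP; apply: contraNT xn0; rewrite negb_exists => /forallP xle0.
  apply/eqP/ffunP => s; rewrite ffunE; apply/eqP.
  by rewrite eq_le x0 andbT leNgt xle0.
have sumB s : \sum_u (x - unitv s) u = \sum_u x u - 1.
  rewrite (eq_bigr (fun u => x u - (u == s)%:R)); last first.
    by move=> u _; rewrite !ffunE.
  rewrite big_split /= sumrN; congr (_ - _).
  by rewrite (bigD1 s) //= eqxx big1 ?addr0 // => u /negbTE ->.
have sum_gt0 : 0 < \sum_u x u.
  by rewrite (bigD1 t) //= ltr_wpDr // sumr_ge0.
rewrite {1}/psi; case E : (absz (\sum_u x u)) => [|n].
  by move/eqP: E; rewrite absz_eq0 gt_eqF.
have {}E : \sum_u x u = n.+1%:Z by rewrite -E gtz0_abs.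
rewrite /= (_ : [forall s, (0 <= x s)%R]); last exact/forallP.
congr minkowski_gauge; apply/funext => s.
by rewrite /psi sumB E intS addrAC subrr add0r.
Qed.

End BalancedFairness.

Arguments harmonic_gap {T} R x.
Arguments vec_of_int {T} R x.

(* Main.v *)
(** The lower bound is an induction: for [g] in [K], [exp (- <g, x>)] is feasible
in the infimum defining [psi x].  For the upper bound, enlarge [C] to a half-space
simplex [\sum_s c s * l s <= 1], for which the balance function is explicit:
[n! * \prod_s c s ^ x s / (x s)!] with [n := \sum_s x s]; enlarging [C]
decreases [psi].  The half-space comes from the first-order optimality of a
maximiser [l*] of the concave function [\sum_s x s * ln (l s)] on [C], namely
[c s = x s / (n * l* s)].  The two estimates [n ^ n / n! <= e ^ n] and
[m! <= m ^ m * e ^ (H_m - m)], with [H_m] the harmonic number, then leave exactly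
the gap [r x].  As [C] need not be closed, the maximiser may not exist: a
near-maximiser gives the same inequalities with [n] replaced by [n + eta]. *)

Require Import Defs.
From mathcomp Require Import all_boot all_order all_algebra.
From mathcomp Require Import all_classical all_reals all_analysis.
From mathcomp Require Import ring lra zify.

Set Implicit Arguments.
Unset Strict Implicit.
Unset Printing Implicit Defensive.

Import Order.TTheory GRing.Theory Num.Theory.

Local Open Scope classical_set_scope.
Local Open Scope ring_scope.

(** * Scalar estimates for factorials and the logarithm *)

Section ScalarInequalities.
Variable R : realType.
Implicit Types (x y u w : R).

Lemma expr_le_fact_expR x n : 0 <= x -> x ^+ n <= n`!%:R * expR x.
Proof.
move=> x0; rewrite mulrC -ler_pdivrMr ?ltr0n ?fact_gt0//.
case: n => [|n]; first by rewrite expr0 divr1 (le_trans _ (expR_ge1Dx x))// lerDl.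
by apply: le_trans (expR_ge1Dxn n x0); rewrite lerDr.
Qed.

(** With [u = 1 / (m + 1)], the induction step is [e ^ (1 - u) * m ^ m <= (m + 1) ^ m]: the [m]-th
    power of [e ^ u * (1 - u) <= 1], since [m * u = 1 - u]. *)
Lemma fact_le_expr_harmonic m :
  m`!%:R * expR (m%:R - \sum_(1 <= i < m.+1) i%:R^-1) <= m%:R ^+ m :> R.
Proof.
elim: m => [|m IH]; first by rewrite big_nil subr0 expR0 mul1r expr0.
have m1 : m.+1%:R != 0 :> R by rewrite pnatr_eq0.
pose u : R := m.+1%:R^-1; have mu : m.+1%:R * u = 1 by rewrite mulfV.
have mE : m%:R = m.+1%:R - 1 :> R by rewrite -natr1 addrK.
have stepE : expR (1 - u) * m%:R ^+ m <= m.+1%:R ^+ m.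
  have base : expR u * m%:R <= m.+1%:R.
    have -> : m%:R = m.+1%:R * (1 - u) :> R.
      by rewrite mulrBr mulr1 mu.
    rewrite mulrCA -[leRHS]mulr1 ler_pM2l ?ltr0n//.
    rewrite -ler_pdivlMl ?expR_gt0// mulr1 -expRN.
    by rewrite (le_trans _ (expR_ge1Dx _)).
  have -> : 1 - u = m%:R * u.
    by rewrite mE mulrBl mu mul1r.
  by rewrite expRM_natl -exprMn lerXn2r// nnegrE ?mulr_ge0// expR_ge0.
rewrite big_nat_recr//= factS natrM.
rewrite (_ : m.+1%:R - _ = (m%:R - \sum_(1 <= i < m.+1) i%:R^-1) + (1 - u)).
  rewrite expRD exprS mulrA -[X in X * _]mulrA -mulrA ler_pM2l ?ltr0n//.
  by rewrite (le_trans _ stepE)// [leRHS]mulrC ler_pM2r// expR_gt0.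
by rewrite mE /u; ring.
Qed.

Lemma ln_ge1BV w : 0 < w -> 1 - w^-1 <= ln w.
Proof.
move=> w0; have := @le_ln1Dx R (w^-1 - 1); rewrite addrCA subrr addr0 lnV//.
by rewrite ltrBrDl subrr invr_gt0 => /(_ w0); lra.
Qed.

End ScalarInequalities.

(** * Induction along the recursion for [psi], and the lower bound *)

Section BalanceFunction.
Variables (T : finType) (R : realType).
Implicit Types (C : set (T -> R^o)) (x : {ffun T -> int}).

Lemma sum_sub_unitv x s : \sum_u (x - unitv s) u = \sum_u x u - 1.
Proof.
rewrite (eq_bigr (fun u => x u - (u == s)%:R)); last by move=> u _; rewrite !ffunE.
rewrite big_split /= sumrN; congr (_ - _).
by rewrite (bigD1 s) //= eqxx big1 ?addr0 // => u /negbTE ->.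
Qed.

(* Stated in [R] rather than in the regular module [R^o], for the sake of [ring] and [lra]. *)
Lemma dotp_intE (g : T -> R) x :
  dotp g (vec_of_int R x) = \sum_s g s * (x s)%:~R :> R.
Proof. by []. Qed.

Lemma dotp_sub_unitv (g : T -> R) x s :
  dotp g (vec_of_int R (x - unitv s)) = dotp g (vec_of_int R x) - g s.
Proof.
rewrite !dotp_intE (bigD1 s)//= [in RHS](bigD1 s)//= !ffunE eqxx addrAC.
congr (_ + _); first by rewrite rmorphB/=; ring.
by apply: eq_bigr => u us; rewrite !ffunE (negbTE us) subr0.
Qed.

Lemma sum_ffun_int_gt0 x : (forall s, 0 <= x s) -> x != 0 -> 0 < \sum_s x s.
Proof.
move=> x0 xn0; rewrite lt0r sumr_ge0// andbT; apply: contraNneq xn0 => x_eq0.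
apply/eqP/ffunP => t; rewrite ffunE; apply/eqP.
by move/eqP: x_eq0; rewrite psumr_eq0// => /allP/(_ t); apply; rewrite mem_index_enum.
Qed.

(** Induction on the coordinate sum. Points outside the orthant get their own case because
    [x - unitv s] may leave it. *)
Lemma ffun_int_ge0_ind (P : {ffun T -> int} -> Prop) : P 0 ->
  (forall x, ~ (forall s, 0 <= x s) -> P x) ->
  (forall x, (forall s, 0 <= x s) -> x != 0 -> (forall s, P (x - unitv s)) -> P x) ->
  forall x, P x.
Proof.
move=> P0 Pout Pstep x.
have [n] := ubnP (absz (\sum_s x s)); elim: n => // n IH in x *.
have [x0|/Pout//] := pselect (forall s, 0 <= x s).
have [->//|xn0] := eqVneq x 0; rewrite ltnS => xn; apply: Pstep => // s.
apply: IH; apply: leq_trans xn; rewrite sum_sub_unitv.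
by move: (\sum_u x u) (sum_ffun_int_gt0 x0 xn0) => k; lia.
Qed.

Lemma minkowski_gauge_ge C (v : T -> \bar R) (b : R) :
  (forall a l, 0 < a -> C l -> (forall s, v s = (a * l s)%:E) -> b <= a) ->
  (b%:E <= minkowski_gauge C v)%E.
Proof.
move=> vb; apply: le_ereal_inf_tmp => _ [a [a0 [l Cl lE]] <-]; rewrite lee_fin.
apply: (vb a l) => // s.
by rewrite EFinM lE muleA -EFinM mulfV ?gt_eqF// mul1e.
Qed.

Lemma psi_ge0 C x : (0 <= psi C x)%E.
Proof.
have [x0|/psi_out->//] := pselect (forall s, 0 <= x s).
have [->|xn0] := eqVneq x 0; first by rewrite psi0.
by rewrite psiE//; apply: minkowski_gauge_ge => a l /ltW.
Qed.

Lemma psi_le_expR C x (g : T -> R^o) : C `<=` orthant (R := R) (T := T) ->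
  nonincreasing_set C -> log_set C g ->
  (psi C x <= (expR (- dotp g (vec_of_int R x)))%:E)%E.
Proof.
move=> CR Cdec Kg; elim/ffun_int_ge0_ind: x => [|x|x x0 xn0 IH].
- rewrite psi0 /dotp big1 ?oppr0 ?expR0// => s _.
  by rewrite /vec_of_int ffunE mulr0.
- by move/psi_out ->; rewrite lee_fin expR_ge0.
set a := expR _; have a0 : 0 < a by exact: expR_gt0.
have psi_fin s : psi C (x - unitv s) = (fine (psi C (x - unitv s)))%:E.
  by rewrite fineK// ge0_fin_numE ?psi_ge0// (le_lt_trans (IH s))// ltry.
rewrite psiE//; apply: ereal_inf_lbound; exists a => //; split => //.
exists (fun s => a^-1 * fine (psi C (x - unitv s))); last first.
  by move=> s; rewrite EFinM -psi_fin.
have l0 s : 0 <= a^-1 * fine (psi C (x - unitv s)).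
  by rewrite mulr_ge0 ?invr_ge0 ?fine_ge0 ?psi_ge0// ltW.
(* By induction [psi (x - e_s) <= a * exp (g s)], so the rescaled vector lies below [exp g]. *)
apply: Cdec Kg => // s.
rewrite ler_pdivrMl// -lee_fin -psi_fin (le_trans (IH s))// lee_fin.
by rewrite /a -expRD ler_expR dotp_sub_unitv opprB addrC.
Qed.

(** * Multinomial weights and half-space simplices *)

Definition multinomial_weight (c : T -> R) x : R :=
  (absz (\sum_s x s))`!%:R * \prod_s (c s ^+ absz (x s) / (absz (x s))`!%:R).

(** Lowering [x s] by one divides [n!] by [n] and the factor at [s] by [c s / x s]; the
    multiplied-out form also covers [c s = 0]. *)
Lemma multinomial_weight_sub_unitv (c : T -> R) x s :
  (forall t, 0 <= x t) -> 0 < x s ->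
  c s * multinomial_weight c (x - unitv s) * (\sum_t x t)%:~R =
  (x s)%:~R * multinomial_weight c x.
Proof.
move=> x0 xs0; rewrite /multinomial_weight sum_sub_unitv.
have [k xsE] : exists k : nat, x s = k.+1%:Z.
  by exists (absz (x s)).-1; lia.
have [n sumE] : exists n : nat, \sum_t x t = n.+1%:Z.
  have : 0 < \sum_t x t by rewrite (bigD1 s)//= ltr_wpDr// sumr_ge0.
  by move: (\sum_t x t) => m m0; exists (absz m).-1; lia.
have subn m : (m.+1%:Z - 1 = m%:Z)%R by lia.
rewrite sumE subn (bigD1 s)//= [in RHS](bigD1 s)//= !ffunE eqxx xsE subn !absz_nat.
rewrite (eq_bigr (fun t => c t ^+ absz (x t) / (absz (x t))`!%:R)); last first.
  by move=> t ts; rewrite !ffunE (negbTE ts) subr0.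
move: (\prod_(t | t != s) _) => P; rewrite exprS !factS !natrM -!pmulrn.
by field; rewrite nat1r !pnatr_eq0 -lt0n fact_gt0.
Qed.

(** Pascal's rule: in the sum over [s] of the preceding identity, the coefficients [x s] add up to
    [n], which cancels. *)
Lemma multinomial_weight_rec (c : T -> R) x : (forall s, 0 <= x s) -> x != 0 ->
  multinomial_weight c x =
  \sum_(s | 0 < x s) c s * multinomial_weight c (x - unitv s).
Proof.
move=> x0 xn0; have n0 : (\sum_s x s)%:~R != 0 :> R.
  by rewrite intr_eq0 gt_eqF// sum_ffun_int_gt0.
apply: (mulIf n0); rewrite mulr_suml.
rewrite [RHS](eq_bigr _ (fun s xs => multinomial_weight_sub_unitv c x0 xs)).
rewrite -mulr_suml -rmorph_sum/= mulrC; congr (_%:~R * _).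
rewrite [RHS]big_mkcond; apply: eq_bigr => s _.
by case: ifPn => //; rewrite -leNgt => xs; apply/eqP; rewrite eq_le xs x0.
Qed.

(** If [psi (x - e_s) = a * l s] with [l] in [C], Pascal's rule and induction bound the weight by
    [a * \sum_s c s * l s <= a]. *)
Lemma multinomial_weight_le_psi C (c : T -> R) x :
  C `<=` orthant (R := R) (T := T) -> (forall s, 0 <= c s) ->
  (forall l, C l -> \sum_s c s * l s <= 1) -> (forall s, 0 <= x s) ->
  ((multinomial_weight c x)%:E <= psi C x)%E.
Proof.
move=> CR c0 cC; elim/ffun_int_ge0_ind: x => [_|//|x x0 xn0 IH _].
  rewrite psi0 /multinomial_weight !big1 ?fact0 ?mulr1// => s _; rewrite ffunE//.
  by rewrite expr0 fact0 divr1.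
rewrite psiE//; apply: minkowski_gauge_ge => a l a0 Cl psil.
rewrite multinomial_weight_rec//.
apply: (@le_trans _ _ (\sum_(s | 0 < x s) a * (c s * l s))).
  apply: ler_sum => s xs; rewrite [leRHS]mulrCA ler_wpM2l// -lee_fin -psil.
  apply: IH => t; rewrite !ffunE subr_ge0.
  by case: eqVneq => [->|//]; rewrite -gtz0_ge1.
rewrite -mulr_sumr -[leRHS]mulr1 ler_pM2l//; apply: le_trans (cC l Cl).
rewrite big_mkcond/=; apply: ler_sum => s _.
by case: ifP => // _; rewrite mulr_ge0// (CR l Cl s).
Qed.

Lemma sum_absz (x : {ffun T -> int}) : (forall s, 0 <= x s) ->
  absz (\sum_s x s) = (\sum_s absz (x s))%N.
Proof.
move=> x0; rewrite (_ : \sum_s x s = (\sum_s absz (x s))%N%:Z) ?absz_nat//.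
by rewrite (big_morph Posz PoszD erefl); apply: eq_bigr => s _; rewrite gez0_abs.
Qed.

(** Multiplied by [(n + eta) ^ n], the inequality splits into
    [e ^ (- (n + eta)) * (n + eta) ^ n <= n!] and one harmonic factorial bound per coordinate. *)
Lemma expR_le_multinomial_weight x (g : T -> R) (eta : R) :
  0 < eta -> (forall s, 0 <= x s) ->
  expR (- (dotp g (vec_of_int R x) + harmonic_gap R x + eta)) <=
  multinomial_weight
    (fun s => (x s)%:~R / (expR (g s) * ((\sum_s x s)%:~R + eta))) x.
Proof.
move=> eta0 x0; rewrite /multinomial_weight dotp_intE /harmonic_gap.
pose k s := absz (x s); pose n := (\sum_s k s)%N.
pose H m : R := \sum_(1 <= i < m.+1) i%:R^-1.
have xE s : (x s)%:~R = (k s)%:R :> R by rewrite /k -[in LHS](gez0_abs (x0 s)).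
have -> : (\sum_s x s)%:~R = n%:R :> R.
  by rewrite rmorph_sum/= natr_sum; apply: eq_bigr => s _; exact: xE.
have neta : 0 < n%:R + eta by rewrite ltr_wpDl.
have -> : \sum_(s | 0 < x s) \sum_(1 <= m < (absz (x s)).+1) m%:R^-1 = \sum_s H (k s).
  rewrite big_mkcond; apply: eq_bigr => s _; case: ifPn => // xs.
  have -> : k s = 0%N by rewrite /k; have := x0 s; lia.
  by rewrite /H big_geq.
rewrite sum_absz// -/n.
have factor s : expR (- (g s * (k s)%:R)) * expR ((k s)%:R - H (k s)) <=
    ((x s)%:~R / (expR (g s) * (n%:R + eta))) ^+ k s / (k s)`!%:R * (n%:R + eta) ^+ k s.
  rewrite xE mulrAC -exprMn invfM mulrA mulfVK ?gt_eqF//.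
  rewrite exprMn -expRN -expRM_natr mulNr.
  rewrite mulrC mulrAC ler_pM2r ?expR_gt0// ler_pdivlMr ?ltr0n ?fact_gt0// mulrC.
  exact: fact_le_expr_harmonic.
have fact_n : expR (- (n%:R + eta)) * (n%:R + eta) ^+ n <= n`!%:R.
  by rewrite expRN mulrC ler_pdivrMr ?expR_gt0// expr_le_fact_expR// ltW.
have expE : expR (- (\sum_s g s * (x s)%:~R + \sum_s H (k s) + eta)) =
    expR (- (n%:R + eta)) *
    \prod_s (expR (- (g s * (k s)%:R)) * expR ((k s)%:R - H (k s))).
  rewrite big_split/= -!expR_sum -!expRD; congr expR.
  rewrite sumrN sumrB /n natr_sum.
  by under eq_bigr do rewrite xE; ring.
rewrite expE -(ler_pM2r (exprn_gt0 n neta)) mulrAC -[leRHS]mulrA.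
apply: ler_pM => //.
- by rewrite mulr_ge0 ?expR_ge0 ?exprn_ge0 ?(ltW neta).
- by rewrite prodr_ge0// => s _; rewrite mulr_ge0 ?expR_ge0.
rewrite /n -prodrXr -big_split/=; apply: ler_prod => s _.
by rewrite factor mulr_ge0.
Qed.

(** * Near-maximisers over the logarithmic set and their almost-supporting half-spaces *)

Lemma log_set_segment C (g l : T -> R) (t : R) :
  C `<=` orthant (R := R) (T := T) -> convex_set C -> log_set C g -> C l ->
  0 <= t < 1 ->
  log_set C (fun s => g s + ln (1 + t * (l s / expR (g s) - 1))).
Proof.
move=> CR Ccvx Kg Cl /andP[t0 t1].
have := Ccvx l (fun s => expR (g s)) (Itv01 t0 (ltW t1)).
rewrite !inE => /(_ Cl Kg); congr C; apply/funext => s.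
have g0 := expR_gt0 (g s).
(* This is the ratio of [t * l s + (1 - t) * expR (g s)] to [expR (g s)]; [t < 1] keeps it positive
   where [l s = 0]. *)
have ratio0 : 0 < 1 + t * (l s / expR (g s) - 1).
  have : 0 <= t * (l s / expR (g s)).
    by rewrite mulr_ge0// divr_ge0 ?expR_ge0//; exact: CR.
  by rewrite mulrBr mulr1; lra.
rewrite expRD lnK//.
rewrite [LHS](_ : _ = t * l s + (1 - t) * expR (g s) :> R).
  by field; rewrite gt_eqF.
by [].
Qed.

Lemma ln1D_ge (u : R) : - 2^-1 <= u -> u - 2 * u ^+ 2 <= ln (1 + u).
Proof.
move=> u2; have u1 : 0 < 1 + u by lra.
apply: le_trans (ln_ge1BV u1).
rewrite -subr_ge0 (_ : _ - _ = u ^+ 2 * (1 + 2 * u) / (1 + u)).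
  by rewrite divr_ge0 ?(ltW u1)// mulr_ge0 ?sqr_ge0//; lra.
by field; rewrite gt_eqF.
Qed.

(* Optimality of [g] for [dotp g x] over the segment joining [expR g] to [l],
   to first order at [expR g]; at the maximiser itself one can take [eta = 0]. *)
Lemma log_set_almost_support C x (D eta : R) :
  C `<=` orthant (R := R) (T := T) -> convex_set C -> log_set C !=set0 ->
  (forall s, 0 <= x s) ->
  (forall g, log_set C g -> dotp g (vec_of_int R x) <= D) -> 0 < eta ->
  exists2 g, log_set C g &
    forall l, C l ->
      \sum_s (x s)%:~R * (l s / expR (g s)) <= (\sum_s x s)%:~R + eta :> R.
Proof.
move=> CR Ccvx [h Kh] x0 Dub eta0.
pose w s : R := (x s)%:~R; pose n : R := \sum_s w s.
have w0 s : 0 <= w s by rewrite ler0z.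
have n0 : 0 <= n by rewrite sumr_ge0.
(* [M] will bound [(z s - 1) ^ 2] uniformly in [l]. The step [t] makes the second-order error
   [2 * t * n * M] at most [eta / 2]; the slack [e] costs at most another [eta / 2] after division
   by [t]. All are fixed before [l], since [g] must serve every [l]. *)
pose M : R := (2 * expR (1 + n)) ^+ 2.
have M0 : 0 <= M by exact: sqr_ge0.
have den0 : 0 < 4 * n * M + 2 * eta by rewrite ltr_wpDl ?mulr_ge0// mulr_gt0.
pose t := eta / (4 * n * M + 2 * eta).
have t0 : 0 < t by rewrite divr_gt0.
have tE : 4 * t * n * M + 2 * t * eta = eta.
  by rewrite /t; field; rewrite gt_eqF.
have t_half : t <= 2^-1.
  rewrite ler_pdivrMr//; have : 0 <= n * M by rewrite mulr_ge0.
  lra.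
pose e := Order.min 1 (t * eta / 2).
have e0 : 0 < e by rewrite lt_min ltr01 divr_gt0 ?(mulr_gt0 t0).
pose S := [set dotp g (vec_of_int R x) | g in log_set C].
have supS : has_sup S.
  split; first by exists (dotp h (vec_of_int R x)), h.
  by exists D => _ [g Kg <-]; exact: Dub.
have [_ [g Kg <-] gsup] := sup_adherent e0 supS.
exists g => // l Cl.
pose z s : R := l s / expR (g s).
have z0 s : 0 <= z s by rewrite divr_ge0 ?expR_ge0//; exact: CR.
(* As [g] is within [e] of the supremum, moving towards [l] gains at most [e]. *)
have seg u : 0 <= u < 1 -> \sum_s w s * ln (1 + u * (z s - 1)) <= e.
  move=> u01; have Ku := log_set_segment CR Ccvx Kg Cl u01.
  have := sup_upper_bound supS; move=> /(_ _ (ex_intro2 _ _ _ Ku erefl)).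
  rewrite -/S => ub; rewrite -(lerD2l (dotp g (vec_of_int R x))).
  apply: le_trans (_ : sup S <= _); last by rewrite -lerBlDr ltW.
  apply: le_trans ub; rewrite !dotp_intE -big_split/=.
  by apply: ler_sum => s _; rewrite mulrDl [_ * ln _]mulrC.
(* At the midpoint every logarithm is at least [-1], so the term at [s] is at most [e + n <= 1 + n].
   Integrality gives [w s >= 1], hence a bound on [z s] itself. *)
have zM s : 0 < x s -> (z s - 1) ^+ 2 <= M.
  move=> xs.
  have w1 : 1 <= w s by rewrite ler1z -gtz0_ge1.
  have half0 : 0 < 1 + 2^-1 * (z s - 1) by have := z0 s; lra.
  have := seg 2^-1; rewrite invr_ge0 ler0n invf_lt1// ltr1n => /(_ isT).
  rewrite (bigD1 s)//= => seg_half.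
  have rest : - n <= \sum_(u | u != s) w u * ln (1 + 2^-1 * (z u - 1)).
    rewrite /n -sumrN [leLHS](bigD1 s)//= -[leRHS]add0r lerD ?oppr_le0//.
    apply: ler_sum => u _; rewrite -[leLHS]mulrN1 ler_wpM2l//.
    have u0 : 0 < 1 + 2^-1 * (z u - 1) by have := z0 u; lra.
    have : (1 + 2^-1 * (z u - 1))^-1 <= 2.
      by rewrite invf_ple ?posrE//; have := z0 u; lra.
    by have := ln_ge1BV u0; lra.
  have e1 : e <= 1 by rewrite ge_min lexx.
  have lnz : ln (1 + 2^-1 * (z s - 1)) <= 1 + n.
    have [ln0|/ltW ln0] := leP (ln (1 + 2^-1 * (z s - 1))) 0; first by lra.
    by apply: (le_trans (ler_peMl ln0 w1)); lra.
  have zB : 1 + 2^-1 * (z s - 1) <= expR (1 + n).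
    by rewrite -[leLHS]lnK ?posrE// ler_expR.
  have B1 : 1 <= expR (1 + n) by have := expR_ge1Dx (1 + n); lra.
  have zs0 := z0 s.
  rewrite -[leLHS]real_normK ?num_real// lerXn2r ?nnegrE ?mulr_ge0 ?expR_ge0//.
  by rewrite ler_norml; apply/andP; split; lra.
(* [ln1D_ge] applies because [t * (z s - 1) >= - t >= - 1/2]; coordinates with [x s = 0], not
   covered by [zM], have weight zero. *)
have first_order : \sum_s w s * (t * (z s - 1) - 2 * t ^+ 2 * M) <= e.
  apply: le_trans (seg t _); last by rewrite ltW//=; lra.
  apply: ler_sum => s _; have [xs|] := ltP 0 (x s); last first.
    move=> xs; have -> : w s = 0 by apply/eqP; rewrite intr_eq0 eq_le xs x0.
    by rewrite !mul0r.
  rewrite ler_wpM2l//; apply: le_trans (ln1D_ge _); last first.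
    have : 0 <= t * z s by rewrite mulr_ge0// ltW.
    by rewrite mulrBr mulr1; lra.
  by rewrite lerD2l lerN2 exprMn mulrA ler_wpM2l ?zM// mulr_ge0// sqr_ge0.
have {first_order} : t * (\sum_s w s * z s - n - 2 * t * n * M) <= e.
  apply: le_trans first_order; rewrite le_eqVlt; apply/orP; left; apply/eqP.
  rewrite (_ : 2 * t * n * M = n * (2 * t * M)); last by ring.
  rewrite /n mulr_suml -!sumrB mulr_sumr; apply: eq_bigr => s _.
  by ring.
have : e <= t * (eta / 2) by rewrite ge_min mulrA lexx orbT.
move=> /[swap] /le_trans /[apply]; rewrite ler_pM2l// => bound.
rewrite rmorph_sum/= -/n.
have tn : 0 <= t * eta by rewrite mulr_ge0// ltW.
have tnM : 2 * t * n * M <= eta / 2 by lra.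
change (\sum_s w s * z s <= n + eta); lra.
Qed.

Lemma fenchel_indicator_ge C x (g : T -> R) : log_set C g ->
  ((dotp g (vec_of_int R x))%:E <=
   fenchel (indicator_fun (log_set C)) (vec_of_int R x))%E.
Proof.
move=> Kg; apply: ereal_sup_ubound; exists g => //=.
by rewrite /indicator_fun; case: pselect => [Kg'|/(_ Kg)//]; rewrite sube0.
Qed.

End BalanceFunction.

(** * Passage from bounds on [psi] to bounds on [phi] *)

Theorem theorem6 (T : finType) (R : realType) (C : set (T -> R^o))
    (C_orthant : C `<=` @orthant T R)
    (C_convex : convex_set C)
    (C_nonincr : nonincreasing_set C)
    (K_nonempty : log_set C !=set0)
    (x : {ffun T -> int}) (x_ge0 : forall s, 0 <= x s) :
  (fenchel (indicator_fun (log_set C)) (vec_of_int R x) <= phi C x)%E /\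
  (phi C x <= fenchel (indicator_fun (log_set C)) (vec_of_int R x)
              + (harmonic_gap R x)%:E)%E.
Proof.
have lne_psi (b : R) :
    ((b%:E <= lne (psi C x)) = ((expR b)%:E <= psi C x))%E *
    ((lne (psi C x) <= b%:E) = (psi C x <= (expR b)%:E))%E.
  have lneb : lne (expR b)%:E = b%:E by rewrite lne_EFin ?expR_gt0// expRK.
  by rewrite -lneb !lee_lne ?in_itv/= ?leey ?psi_ge0 ?lee_fin ?expR_ge0.
split.
  apply: ge_ereal_sup => _ [g _ <-]; rewrite /indicator_fun.
  case: pselect => [Kg|nKg]; last by rewrite addeNy leNye.
  by rewrite sube0 /phi leeNr -EFinN lne_psi psi_le_expR.
have [g0 Kg0] := K_nonempty.
have : forall g, log_set C g -> ((dotp g (vec_of_int R x))%:E <=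
    fenchel (indicator_fun (log_set C)) (vec_of_int R x))%E.
  by move=> g; exact: fenchel_indicator_ge.
(* If the conjugate is [+oo] the bound is trivial; [-oo] is excluded by [g0]. In the real case [eta]
   absorbs the lack of an exact maximiser. *)
case: (fenchel _ _) => [D||] fge.
- apply/lee_addgt0Pr => eta eta0; rewrite /phi leeNl -!EFinD -EFinN lne_psi.
  have [g Kg gC] := log_set_almost_support C_orthant C_convex K_nonempty x_ge0 fge eta0.
  have neta : 0 < (\sum_s x s)%:~R + eta :> R.
    by rewrite ltr_wpDl// ler0z sumr_ge0.
  apply: le_trans (multinomial_weight_le_psi C_orthant _ _ x_ge0).
  + rewrite lee_fin; apply: le_trans (expR_le_multinomial_weight g eta0 x_ge0).
    rewrite ler_expR lerN2 -!addrA lerD2r; exact: fge.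
  + by move=> s; rewrite divr_ge0 ?ler0z// mulr_ge0 ?expR_ge0// ltW.
  (* Dividing the almost-support inequality by [n + eta] puts [C] in the half-space of [c]. *)
  + move=> l /gC; rewrite -[X in _ <= X -> _]mul1r -ler_pdivrMr//.
    apply: le_trans; rewrite mulr_suml; apply: ler_sum => s _.
    by rewrite invfM mulrAC !mulrA -[X in X * _]mulrAC.
- by rewrite addye// leey.
- by have := fge _ Kg0; rewrite leeNy_eq.
Qed.
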